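(* Let $G$ be a simple graph on $[n]$, let $I_G\subseteq\mathbb{R}[x_1,\dots,x_n]$ be generated by the monomials $x_ix_j$ with $i\neq j$ and $\{i,j\}$ not an edge of $G$, and let $X_G=\mathbb{V}(I_G)\subseteq\mathbb{P}^{n-1}$. Then the Hankel index $\eta(X_G)$ equals the smallest integer $p\geq2$ such that $G$ contains an induced cycle of length $p+2$ (and $\eta(X_G)=\infty$ if $G$ has no induced cycle of length $\geq4$).
   Context: $R=\mathbb{R}[x_1,\dots,x_n]/I_G$; $\Sigma_{X_G}\subseteq R_2$ is the cone of sums of squares of elements of $R_1$, with dual cone $\Sigma_{X_G}^*$ regarded inside $\mathbb{R}[x_1,\dots,x_n]_2^*$. For $\ell$ in that space, its rank is the rank of the bilinear form $(f,g)\mapsto\ell(fg)$ on linear forms. The Hankel index $\eta(X)$ is the smallest integer $p>1$ such that $\Sigma_X^*$ has an extreme ray of rank $p$, and $\infty$ if all extreme rays have rank $1$. An induced cycle is a cycle which is an induced subgraph (chordless). *)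

(* Defs.v *)
From HB Require Import structures.
From mathcomp Require Import all_boot all_order all_algebra.
Set Implicit Arguments. Unset Strict Implicit. Unset Printing Implicit Defensive.
Import Order.TTheory GRing.Theory Num.Theory.
Local Open Scope ring_scope.

Definition simple_graph (n : nat) (e : rel 'I_n) : Prop :=
  (forall i j, e i j = e j i) /\ (forall i, e i i = false).

(* Linear forms in x_1..x_n are column vectors f : 'cV_n (f = sum_i f_i x_i).
   An element ell of R[x_1..x_n]_2^dual is determined by its values on the
   monomials x_i x_j; we encode it by the symmetric matrix L with
   L i j = ell(x_i x_j).  Then ell(f g) = f^T L g. *)
Definition ell_prod (R : rcfType) (n : nat) (L : 'M[R]_n) (f g : 'cV[R]_n) : R :=
  ((f^T) *m L *m g) 0 0.

(* ell lies in the dual cone Sigma_{X_G}^dual (viewed inside R[x]_2^dual):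
   ell is a functional on R_2 = R[x]_2 / (I_G)_2, i.e. vanishes on (I_G)_2,
   which is spanned by x_i x_j, i != j, {i,j} not an edge; and
   ell is nonnegative on every sum of squares of linear forms. *)
Definition in_sigma_dual (R : rcfType) (n : nat) (e : rel 'I_n) (L : 'M[R]_n) : Prop :=
  [/\ L^T = L,
      (forall i j : 'I_n, i != j -> ~~ e i j -> L i j = 0) &
      (forall (m : nat) (fs : 'I_m -> 'cV[R]_n),
          0 <= \sum_(k < m) ell_prod L (fs k) (fs k))].

Definition extreme_ray (R : rcfType) (n : nat) (e : rel 'I_n) (L : 'M[R]_n) : Prop :=
  [/\ in_sigma_dual e L, L != 0 &
      forall A B : 'M[R]_n, in_sigma_dual e A -> in_sigma_dual e B -> L = A + B ->
        exists2 c : R, 0 <= c & A = c *: L].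

(* Rank of ell = rank of the bilinear form (f,g) |-> ell(fg), i.e. \rank L. *)
Definition has_extreme_ray_of_rank (R : rcfType) (n : nat) (e : rel 'I_n) (p : nat) : Prop :=
  exists L : 'M[R]_n, extreme_ray e L /\ \rank L = p.

(* eta = Some p : Hankel index is p;  eta = None : Hankel index is infinity. *)
Definition hankel_index_is (R : rcfType) (n : nat) (e : rel 'I_n) (eta : option nat) : Prop :=
  match eta with
  | Some p => [/\ (1 < p)%N, has_extreme_ray_of_rank R e p &
                 forall q : nat, (1 < q)%N -> (q < p)%N -> ~ has_extreme_ray_of_rank R e q]
  | None => forall L : 'M[R]_n, extreme_ray e L -> \rank L = 1%N
  end.

Definition has_induced_cycle (n : nat) (e : rel 'I_n) (k : nat) : Prop :=
  (3 <= k)%N /\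
  exists v : 'I_k -> 'I_n, injective v /\
    forall i j : 'I_k,
      e (v i) (v j) = ((val j == i.+1 %% k)%N || (val i == j.+1 %% k)%N).

Definition cycle_index_is (n : nat) (e : rel 'I_n) (eta : option nat) : Prop :=
  match eta with
  | Some p => [/\ (2 <= p)%N, has_induced_cycle e (p + 2) &
                 forall q : nat, (2 <= q)%N -> (q < p)%N -> ~ has_induced_cycle e (q + 2)]
  | None => forall k : nat, (4 <= k)%N -> ~ has_induced_cycle e k
  end.

(* Main.v *)
(* Write L = V V^T, with rows v_i, so that v_i and v_j are orthogonal whenever
   i and j are distinct and not adjacent.

   A cycle of length p + 2 carries p-dimensional vectors whose Gram matrix has a
   two-dimensional kernel.  A matrix A with 0 <= A <= L inherits this kernel, and
   solving A u = 0 row by row along the cycle leaves only the multiples of L.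

   Conversely, suppose that the shortest induced cycle of length at least 4 has
   length greater than r + 2, where r = rank L >= 2.  Then some nonzero
   a = V y is supported on a clique, so that a a^T / |y|^2 <= L has rank one and
   L is not extreme.  Such an a is found by induction on the number of nonzero
   v_i.  If nonzero v_s and v_t belong to a nonadjacent pair, project all vectors
   orthogonally to the span W of the v_i with i not in N[s].  Either the
   projected vectors still respect the graph, and induction applies, or some
   nonadjacent i, j in N(s) are linked outside N[s] by a chordless path of
   nonorthogonal vectors.  This path has at least r inner vertices because it
   closes to a cycle through s, hence dim W >= r - 1.  In that case project
   orthogonally to v_s, which amounts to making N(s) a clique: induction gives
   some a, and if its support is not a clique of the graph then it lies in N(s)
   (there is no induced 4-cycle), so y is orthogonal to W and v_s, which together
   span all the v_i, contradicting a != 0. *)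
Require Import Defs.
From HB Require Import structures.
From mathcomp Require Import all_boot all_order all_algebra.
From mathcomp Require Import ring lra zify.
Set Implicit Arguments. Unset Strict Implicit. Unset Printing Implicit Defensive.
Import Order.TTheory GRing.Theory Num.Theory.
Local Open Scope ring_scope.

(** * Positive semidefinite matrices *)

Lemma mulmx11 (R : pzSemiRingType) (A B : 'M[R]_1) : (A *m B) 0 0 = A 0 0 * B 0 0.
Proof. by rewrite mxE big_ord1. Qed.

Lemma mulmx_trmx_ge0 (R : rcfType) m (x : 'rV[R]_m) : 0 <= (x *m x^T) 0 0.
Proof. by rewrite mxE sumr_ge0 // => i _; rewrite mxE -expr2 sqr_ge0. Qed.

Lemma mulmx_trmx_eq0 (R : rcfType) m (x : 'rV[R]_m) : x *m x^T = 0 -> x = 0.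
Proof.
move=> /matrixP /(_ 0 0); rewrite !mxE => /eqP.
rewrite psumr_eq0 => [/allP x0|i _]; last by rewrite mxE -expr2 sqr_ge0.
apply/rowP => i; have := x0 i (mem_index_enum i).
by rewrite !mxE -expr2 sqrf_eq0 => /eqP.
Qed.

Lemma mxrank_gram (R : rcfType) n m (V : 'M[R]_(n, m)) : \rank (V *m V^T) = \rank V.
Proof.
have kV : (kermx (V *m V^T) <= kermx V)%MS.
  apply/rV_subP => x /sub_kermxP xVV; apply/sub_kermxP/mulmx_trmx_eq0.
  by rewrite trmx_mul mulmxA -(mulmxA x) xVV mul0mx.
have := mxrankS kV; rewrite !mxrank_ker => le_nV.
apply/eqP; rewrite eqn_leq mxrankM_maxl /=.
have := rank_leq_row V; have := rank_leq_row (V *m V^T); lia.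
Qed.

Lemma rank_ge_triangular (R : fieldType) k n m (A : 'M[R]_(n, m))
    (f : 'I_k -> 'I_n) (g : 'I_k -> 'I_m) :
  (forall a, A (f a) (g a) != 0) -> (forall a b : 'I_k, (a < b)%N -> A (f a) (g b) = 0) ->
  (k <= \rank A)%N.
Proof.
move=> Ad Au; set B := mxsub f g A.
have Btrig : is_trig_mx B by apply/is_trig_mxP => i j ij; rewrite mxE Au.
have uB : B \in unitmx.
  rewrite unitmxE det_trig // unitfE; apply/prodf_neq0 => i _; rewrite mxE Ad //.
have -> : k = \rank B by rewrite mxrank_unit.
rewrite /B mxsubrc (leq_trans (mxrankS (rowsub_sub _ _))) //.
rewrite -mxrank_tr trmx_mxsub -(mxrank_tr A).
exact: (mxrankS (rowsub_sub _ _)).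
Qed.

(** For a basis [B] of the row space of [W], the Gram matrix [B *m B^T] is invertible, and B^T (B
    B^T)^-1 B is the projection. It acts on row vectors from the right. *)
Lemma orthogonal_projection (R : rcfType) k m (W : 'M[R]_(k, m)) :
  exists P : 'M[R]_m, [/\ P^T = P, P *m P = P, W *m P = W & (P <= W)%MS].
Proof.
move: (row_base W) (eq_row_base W) (row_base_free W); move: (\rank W) => r B eqBW freeB.
have uG : B *m B^T \in unitmx.
  by rewrite -row_free_unit /row_free mxrank_gram (eqP freeB).
have BP : B *m (B^T *m invmx (B *m B^T) *m B) = B by rewrite !mulmxA mulmxV // mul1mx.
exists (B^T *m invmx (B *m B^T) *m B); split.
- by rewrite !trmx_mul trmxK trmx_inv trmx_mul trmxK mulmxA.
- by rewrite -[LHS](mulmxA (B^T *m _) B) BP.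
- have /submxP[D ->] : (W <= B)%MS by rewrite eqBW.
  by rewrite -[LHS]mulmxA BP.
- by rewrite (submx_trans (submxMl _ _)) // eqBW.
Qed.

Lemma projection_ortho0 (R : rcfType) l k m (W : 'M[R]_(k, m)) (P : 'M[R]_m) (X : 'M[R]_(l, m)) :
  P^T = P -> (P <= W)%MS -> X *m W^T = 0 -> X *m P = 0.
Proof. by move=> PT /submxP[D PD] XW; rewrite -PT PD trmx_mul mulmxA XW mul0mx. Qed.

Definition psd (R : rcfType) n (L : 'M[R]_n) :=
  L^T = L /\ forall x : 'cV[R]_n, 0 <= (x^T *m L *m x) 0 0.

Lemma psd_gram (R : rcfType) n m (V : 'M[R]_(n, m)) : psd (V *m V^T).
Proof.
split=> [|x]; first by rewrite trmx_mul trmxK.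
by rewrite mulmxA -mulmxA -{2}[x]trmxK -trmx_mul mulmx_trmx_ge0.
Qed.

Lemma form_sym (R : rcfType) n (L : 'M[R]_n) (x y : 'cV[R]_n) :
  L^T = L -> (y^T *m L *m x) 0 0 = (x^T *m L *m y) 0 0.
Proof.
move=> LT; rewrite -[RHS]trace_mx11 -mxtrace_tr !trmx_mul LT trmxK mulmxA.
by rewrite trace_mx11.
Qed.

Lemma formD (R : rcfType) n (L : 'M[R]_n) (x y : 'cV[R]_n) (a b : R) : L^T = L ->
  ((a *: x + b *: y)^T *m L *m (a *: x + b *: y)) 0 0 =
  a ^+ 2 * (x^T *m L *m x) 0 0 + 2 * a * b * (x^T *m L *m y) 0 0 + b ^+ 2 * (y^T *m L *m y) 0 0.
Proof.
move=> LT; have := form_sym x y LT.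
rewrite [(_ + _)^T]linearD /= ![(_ *: _)^T]linearZ /=.
rewrite !mulmxDl !mulmxDr -!scalemxAl -!scalemxAr !mxE => ->.
by ring.
Qed.

Lemma psd_CauchySchwarz (R : rcfType) n (L : 'M[R]_n) (x y : 'cV[R]_n) : psd L ->
  (x^T *m L *m y) 0 0 ^+ 2 <= (x^T *m L *m x) 0 0 * (y^T *m L *m y) 0 0.
Proof.
move=> [LT L0]; set b := (x^T *m L *m y) 0 0; set p := (x^T *m L *m x) 0 0.
set q := (y^T *m L *m y) 0 0.
have p0 : 0 <= p := L0 x; have q0 : 0 <= q := L0 y.
have H t u : 0 <= t ^+ 2 * p + 2 * t * u * b + u ^+ 2 * q by rewrite -formD.
have [pz|p_gt0] := eqVneq p 0.
  (* If [p = 0], the form at [t = - (q + 1)], [u = b] equals [- (q + 2) * b ^+ 2], which forces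
     [b = 0]. *)
  have := H (- b * (q + 1)) (b ^+ 2); have := H (- (q + 1)) b; rewrite pz; nra.
have {}p_gt0 : 0 < p by rewrite lt_def p_gt0.
have := H (- b) p; nra.
Qed.

Lemma psd_form_eq0 (R : rcfType) n (L : 'M[R]_n) (x : 'cV[R]_n) :
  psd L -> (x^T *m L *m x) 0 0 = 0 -> L *m x = 0.
Proof.
move=> pL x0; apply/matrixP => i j; rewrite ord1 [RHS]mxE.
have := psd_CauchySchwarz (delta_mx i 0) x pL; rewrite x0 mulr0.
rewrite trmx_delta -mulmxA -rowE => h.
have : (row i (L *m x) 0 0) ^+ 2 == 0 by rewrite eq_le h sqr_ge0.
by rewrite sqrf_eq0 mxE => /eqP.
Qed.

(** For x in the kernel of [L], the value x^T A x lies between 0 and x^T L x = 0, and a zero of a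
    semidefinite form is a kernel vector. Summands of a ray inherit its kernel in this way. *)
Lemma psd_le_ker (R : rcfType) n k (A L : 'M[R]_n) (X : 'M[R]_(n, k)) :
  psd A -> psd (L - A) -> L *m X = 0 -> A *m X = 0.
Proof.
move=> pA [_ pLA] LX; apply/matrixP => i j; rewrite [RHS]mxE.
have Lx : L *m col j X = 0 by rewrite colE mulmxA LX mul0mx.
have /matrixP/(_ i 0) : A *m col j X = 0.
  apply: psd_form_eq0 => //; apply/eqP; rewrite eq_le pA.2 andbT.
  have := pLA (col j X); rewrite mulmxBr mulmxBl -[_ *m L *m _]mulmxA Lx mulmx0.
  by rewrite sub0r mxE oppr_ge0.
by rewrite colE mulmxA -colE !mxE.
Qed.

Lemma form_delta (R : rcfType) n (L : 'M[R]_n) i j :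
  ((delta_mx i 0 : 'cV[R]_n)^T *m L *m (delta_mx j 0 : 'cV[R]_n)) 0 0 = L i j.
Proof. by rewrite trmx_delta -rowE -colE !mxE. Qed.

(** Cholesky elimination, by induction on the number of nonzero diagonal entries: subtracting
    [u *m u^T], with [u] the i-th column over the root of [L i i], clears entry i, and
    Cauchy-Schwarz keeps the rest semidefinite. *)
Lemma psd_factor (R : rcfType) n (L : 'M[R]_n) :
  psd L -> exists m, exists V : 'M[R]_(n, m), L = V *m V^T.
Proof.
have [N] := ubnP #|[set i | L i i != 0]|; elim: N L => // N IH L cL pL.
have [i Li0|L0] := pickP (fun i => L i i != 0); last first.
  exists 0%N, 0; rewrite mul0mx -(mulmx1 L); apply/matrixP => i j.
  have := @psd_form_eq0 _ _ _ (delta_mx j 0) pL; rewrite form_delta => /(_ (eqP (negbFE (L0 j)))).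
  by move=> /matrixP/(_ i 0); rewrite mulmx1 -colE !mxE.
have Lp : 0 < L i i by rewrite lt_def Li0 -form_delta pL.2.
have [LT pL'] := pL.
set u := (Num.sqrt (L i i))^-1 *: col i L.
have uu : u *m u^T = (L i i)^-1 *: (col i L *m (col i L)^T).
  rewrite /u linearZ /= -scalemxAl -scalemxAr scalerA -invfM -expr2 sqr_sqrtr //.
  exact: ltW.
have pM : psd (L - u *m u^T).
  split=> [|x]; first by rewrite linearB /= trmx_mul trmxK LT.
  rewrite mulmxBr mulmxBl uu -scalemxAr -scalemxAl !mulmxA -[_ *m (col i L)^T *m x]mulmxA.
  set b := (x^T *m L *m x).
  have := psd_CauchySchwarz x (delta_mx i 0) pL; rewrite form_delta -mulmxA -colE -/b => h.
  rewrite mxE [X in _ + X]mxE [X in _ - X]mxE mulmx11.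
  have -> : ((col i L)^T *m x) 0 0 = (x^T *m col i L) 0 0.
    by rewrite -[RHS]trace_mx11 -mxtrace_tr trmx_mul trmxK trace_mx11.
  by rewrite subr_ge0 mulrC ler_pdivrMr // -expr2.
have [|m [V LV]] := IH _ _ pM.
  rewrite -ltnS; apply: leq_trans cL; apply: proper_card; apply/properP; split.
    apply/subsetP => j; rewrite !inE; apply: contraNN => /eqP Lj0.
    have Lj : col j L = 0.
      by rewrite colE; apply: psd_form_eq0 => //; rewrite form_delta.
    have Lij : L j i = 0 by rewrite -LT mxE; move/colP/(_ i): Lj; rewrite !mxE.
    by rewrite uu !mxE big_ord1 !mxE Lj0 Lij mul0r mulr0 subr0.
  exists i; rewrite !inE // negbK uu !mxE big_ord1 !mxE.
  by rewrite mulKf // subrr.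
exists (1 + m)%N, (row_mx u V).
by rewrite tr_row_mx mul_row_col -LV addrC subrK.
Qed.

(** * Short induced cycles *)

Lemma shortest_path (T : finType) (e : rel T) x y : connect e x y ->
  exists p, [/\ path e x p, last x p = y, uniq (x :: p) &
    forall a b, (a.+1 < b <= size p)%N -> ~~ e (nth x (x :: p) a) (nth x (x :: p) b)].
Proof.
move=> exy; pose P k := [exists t : k.-tuple T, path e x t && (last x t == y)].
have exP : exists k, P k.
  have [p ep yp] := connectP exy; exists (size p); apply/existsP; exists (in_tuple p).
  by rewrite ep yp eqxx.
case: (ex_minnP exP) => k /existsP[t /andP[et /eqP ty]] kmin.
have minP q : path e x q -> last x q = y -> (k <= size q)%N.
  by move=> eq yq; apply: kmin; apply/existsP; exists (in_tuple q); rewrite eq yq eqxx.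
have [p [ep up sub_pt yp]] :
    exists p : seq T, [/\ path e x p, uniq (x :: p), {subset p <= t} & last x p = y].
  by case/shortenP: et ty => p; exists p.
have sp : (size p <= k)%N.
  by rewrite -(size_tuple t); apply: uniq_leq_size => //; case/andP: up.
exists p; split=> // a b /andP[ab bp]; apply/negP => eab.
case: b => // b in ab bp eab *.
(* The chord replaces the stretch between its two ends, which gives a path shorter than the
   minimum. *)
have : path e x (take a p ++ drop b p) /\ last x (take a p ++ drop b p) = y.
  rewrite (drop_nth x bp) cat_path last_cat /=.
  have -> : last x (take a p) = nth x (x :: p) a.
    rewrite (last_nth x) size_takel; last by lia.
    by case: (a) => //= a'; rewrite nth_take.
  have epa : path e x (take a p ++ drop a p) by rewrite cat_take_drop.
  have epb : path e x (take b p ++ drop b p) by rewrite cat_take_drop.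
  have ypb : last x (take b p ++ drop b p) = y by rewrite cat_take_drop.
  move: epa epb ypb; rewrite !cat_path last_cat (drop_nth x bp) /=.
  by case/andP=> -> _ /and3P[_ _ ->] ->; rewrite eab.
case=> eq yq; have := minP _ eq yq.
rewrite size_cat size_drop size_takel; last lia.
lia.
Qed.

Lemma leq_card_setU1 (T : finType) (x : T) (A : {set T}) : (#|x |: A| <= #|A|.+1)%N.
Proof. by rewrite cardsU1 -add1n leq_add2r leq_b1. Qed.

Definition within (T : finType) (e : rel T) (A : {set T}) : rel T :=
  [rel x y | [&& e x y, x \in A & y \in A]].

Lemma path_within (T : finType) (e : rel T) (A : {set T}) x p :
  x \in A -> path (within e A) x p -> path e x p /\ {subset x :: p <= A}.
Proof.
elim: p x => [|y p IH] x xA /=; first by split=> // z; rewrite inE => /eqP ->.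
case/andP=> /and3P[exy _ yA] /IH[//|-> sub]; rewrite exy; split=> // z.
by rewrite inE => /predU1P[-> //|/sub].
Qed.

Lemma within_path (T : finType) (e : rel T) (A : {set T}) x p :
  path e x p -> {subset x :: p <= A} -> path (within e A) x p.
Proof.
elim: p x => //= y p IH x /andP[exy ep] sub; apply/andP; split.
  by rewrite /within /= exy !sub ?inE ?eqxx ?orbT.
by apply: IH => // z zp; rewrite sub // inE zp orbT.
Qed.

(* Every cycle of length at least 4 formed by s, two nonadjacent neighbours of s
   and vertices outside the closed neighbourhood of s has length at least q + 3.
   Connecting sets replace induced paths, which makes the notion easy to transfer
   to the elimination graph [fill s e]. *)
Definition apex_separated n (e : rel 'I_n) (q : nat) : Prop :=
  forall (s i j : 'I_n) (A : {set 'I_n}),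
    e s i -> e s j -> i != j -> ~~ e i j -> (forall c, c \in A -> c != s /\ ~~ e s c) ->
    connect (within e (i |: (j |: A))) i j -> (q <= #|A|)%N.

Lemma apex_separatedW n (e : rel 'I_n) q r : (r <= q)%N -> apex_separated e q -> apex_separated e r.
Proof. by move=> rq sq s i j A *; apply: leq_trans rq _; apply: (sq s i j). Qed.

Lemma cyclic_succ k a b : (3 <= k)%N -> (a <= b < k)%N ->
  (b == a.+1 %% k)%N || (a == b.+1 %% k)%N = (b == a.+1) || (a == 0)%N && (b.+1 == k).
Proof.
move=> k3 /andP[ab bk]; have [bk1|nbk] := eqVneq b.+1 k.
  rewrite bk1 modnn andbT; case: (ltnP a.+1 k) => ak; first by rewrite modn_small.
  have -> : a.+1 = k by lia.
  by rewrite modnn; lia.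
by rewrite !modn_small ?andbF; lia.
Qed.

(** A shortest path from [i] to [j] inside [A] with its ends added is chordless, and closing it
    through [s] gives an induced cycle of length [size p + 2]. If [A] had fewer than [q] elements,
    this would be at most [q + 2]. *)
Lemma no_short_cycle_separated n (e : rel 'I_n) q : simple_graph e ->
  (forall k, (4 <= k <= q + 2)%N -> ~ has_induced_cycle e k) -> apex_separated e q.
Proof.
move=> [eC eI] ncyc s i j A esi esj ij nij sA cij; pose B := i |: (j |: A).
have [p [ep pj up chordless]] : exists p : seq 'I_n,
    [/\ path (within e B) i p, last i p = j, uniq (i :: p) & forall a b,
      (a.+1 < b <= size p)%N -> ~~ within e B (nth i (i :: p) a) (nth i (i :: p) b)].
  exact: shortest_path.
have [|{}ep subp] := path_within _ ep; first by rewrite !inE eqxx.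
have inB k : (k <= size p)%N -> nth i (i :: p) k \in B.
  by move=> kp; apply/subp/mem_nth; rewrite ltnS.
have {}chordless a b : (a.+1 < b <= size p)%N -> ~~ e (nth i (i :: p) a) (nth i (i :: p) b).
  move=> abp; have := chordless a b abp.
  by rewrite /within [X in ~~ X]/= !inB ?andbT //; lia.
have sp2 : (2 <= size p)%N.
  case: p ep pj {up chordless subp inB} => [|x [|y p]] //= => [_ ji|].
    by rewrite ji eqxx in ij.
  by rewrite andbT => exi xj; rewrite -xj exi in nij.
have szp : (size p <= #|A|.+1)%N.
  have : (#|i :: p| <= #|i |: (j |: A)|)%N by apply/subset_leq_card/subsetP.
  rewrite (card_uniqP up) => h; have {}h : ((size p).+1 <= #|i |: (j |: A)|)%N := h.
  by rewrite -ltnS (leq_trans h) // (leq_trans (leq_card_setU1 _ _)) // ltnS leq_card_setU1.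
case: (leqP q #|A|) => // ltAq; exfalso; apply: (ncyc (size p).+2); first lia.
split=> //; first lia.
pose c := s :: i :: p; exists (fun a : 'I_(size p).+2 => nth s c a).
have sNp : s \notin i :: p.
  apply/negP => /subp; rewrite !inE => /or3P[/eqP si|/eqP sj|/sA[/eqP//]].
    by rewrite si eI in esi.
  by rewrite sj eI in esj.
have uc : uniq c by rewrite /c cons_uniq sNp up.
split=> [a b /eqP|].
  by rewrite nth_uniq //= => /eqP ab; apply: val_inj.
have lastj : nth s c (size p).+1 = j.
  by rewrite -pj -nth_last /c /=; case: (p) sp2 => //= x p' _; apply: set_nth_default.
suff adj a b : (a <= b < (size p).+2)%N ->
    e (nth s c a) (nth s c b) = (b == a.+1) || (a == 0)%N && (b.+1 == (size p).+2).
  have k3 : (3 <= (size p).+2)%N by lia.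
  move=> a b; case: (leqP a b) => [ab|/ltnW ab].
    have abk : (a <= b < (size p).+2)%N by rewrite ab ltn_ord.
    by rewrite [RHS]cyclic_succ // -adj.
  have bak : (b <= a < (size p).+2)%N by rewrite ab ltn_ord.
  by rewrite eC [RHS]orbC [RHS]cyclic_succ // -adj.
move=> /andP[ab bk].
have [->|abn] := eqVneq a b; first by rewrite eI; lia.
have nthE k : (k <= size p)%N -> nth s c k.+1 = nth i (i :: p) k.
  by move=> kp; apply: set_nth_default.
case: a ab abn => [|a] ab abn; last first.
  case: b bk ab abn => [//|b] bk ab abn; rewrite !nthE ?orbF; try lia.
  have [[ba]|ba] := eqVneq b.+1 a.+2.
    by rewrite ba; apply: (pathP i ep a); lia.
  apply/negbTE/chordless; lia.
case: b bk ab abn => [//|b] bk _ _; rewrite nthE; last lia.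
have [->|b0] := eqVneq b 0%N; first by rewrite [LHS]esi.
have [[bp]|bp] := eqVneq b.+2 (size p).+2.
  rewrite -nthE; last lia.
  by rewrite bp lastj [LHS]esj orbT.
have ->: (b.+1 == 1%N) = false by lia.
apply/negbTE; have bp' : (b <= size p)%N by lia.
have nij' k : (k <= size p)%N -> k != b -> nth i (i :: p) b != nth i (i :: p) k.
  by move=> kp kb; rewrite nth_uniq // eq_sym.
have := inB b bp'; rewrite /B !in_setU1.
have -> : (nth i (i :: p) b == i) = false.
  by apply/negbTE; apply: (nij' 0%N); rewrite // eq_sym.
have -> : (nth i (i :: p) b == j) = false.
  have -> : j = nth i (i :: p) (size p) by rewrite -lastj nthE.
  by apply/negbTE; apply: (nij' (size p)); lia.
by case/sA.
Qed.

(** Elimination of [s]: its neighbours become a clique, as projecting orthogonally to v_s may make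
    any two of their vectors nonorthogonal. The vertex [s] stays, isolated, so the vertex type does
    not change. *)
Definition fill n (s : 'I_n) (e : rel 'I_n) : rel 'I_n :=
  [rel i j | [&& i != s, j != s, i != j & e i j || e s i && e s j]].

Lemma fill_simple n s (e : rel 'I_n) : simple_graph e -> simple_graph (fill s e).
Proof.
move=> [eC eI]; split=> [i j|i]; last by rewrite /fill /= eqxx !andbF.
by rewrite /fill /= andbCA (eq_sym i j) (eC i j) [e s i && _]andbC.
Qed.

Lemma within_sym n (e : rel 'I_n) A : (forall i j, e i j = e j i) ->
  connect_sym (within e A).
Proof.
by move=> eC; apply: sym_connect_sym => x y; rewrite /within /= eC [_ && (y \in A)]andbC.
Qed.

(** A cycle of the filled graph becomes one of [e] with at most one more vertex. If [s'] is not
    adjacent to [s], new edges are rerouted through [s], which joins [A]; otherwise only an end of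
    the path can use a new edge, the one to [s']. *)
Lemma apex_separated_fill n s (e : rel 'I_n) q : simple_graph e ->
  apex_separated e q.+1 -> apex_separated (fill s e) q.
Proof.
move=> sg sep s' i j A; have [eC eI] := sg; have [fC _] := fill_simple s sg.
have [ss'|nss'] := boolP (e s s'); last first.
  move=> /and4P[s's isn _ + ] /and4P[_ js _ +] ij; rewrite (negbTE nss') !orbF => es'i es'j.
  rewrite /fill /= isn js ij negb_or => /andP[nij _] sA cij.
  suff : (q.+1 <= #|s |: A|)%N by move=> h; rewrite -ltnS (leq_trans h) // leq_card_setU1.
  apply: (sep s' i j) => // [c|].
    rewrite !inE => /predU1P[->|cA]; first by rewrite eq_sym s's eC.
    have [cs' fc] := sA c cA; split=> //; apply/negP => es'c.
    have [cs|cs] := eqVneq c s; first by rewrite -cs eC es'c in nss'.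
    by move: fc; rewrite s's cs eq_sym cs' es'c.
  apply: connect_sub cij => x y /and3P[/and4P[xs ys xy exy] xA yA].
  have sub z : z \in i |: (j |: A) -> z \in i |: (j |: (s |: A)).
    by rewrite !inE => /or3P[] ->; rewrite ?orbT.
  case: (boolP (e x y)) exy => [exy _|_ /= /andP[esx esy]].
    by apply: connect1; rewrite /within /= exy !sub.
  by apply: (@connect_trans _ _ s); apply: connect1;
    rewrite /within /= ?(eC _ s) ?esx ?esy !inE eqxx ?orbT -!in_setU1 !sub.
move=> fi fj ij nfij sA cij.
have nNA c : c \in A :\ s -> [/\ c != s', ~~ e s c & ~~ e s' c].
  rewrite !inE => /andP[cs cA]; have [cs' ] := sA c cA.
  case/and4P: fi => s's _ _ _.
  by rewrite /fill /= s's cs eq_sym cs' ss' negb_or => /andP[].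
case/and4P: fi => s's isn s'i fi; case/and4P: fj => _ js s'j fj.
rewrite ss' /= in fi fj.
move: nfij; rewrite /fill /= isn js ij negb_or => /andP[nij nNij].
(* The path uses no new edge: a vertex of [A] adjacent to [s] would be joined to [s'] by the
   filling, so only [i] or [j] can be adjacent to [s], and not both. *)
have {}cij : connect (within e (i |: (j |: (A :\ s)))) i j.
  apply: connect_sub cij => x y /and3P[/and4P[xs ys xy exy] xA yA].
  have sub z : z != s -> z \in i |: (j |: A) -> z \in i |: (j |: (A :\ s)).
    by move=> zs; rewrite !inE zs.
  apply: connect1; rewrite /within /= (sub x) // (sub y) // !andbT.
  case/orP: exy => // /andP[esx esy]; exfalso.
  have ijN z : z != s -> z \in i |: (j |: A) -> e s z -> (z == i) || (z == j).
    move=> zs /(sub z zs); rewrite !in_setU1 orbA => /orP[//|/nNA[_ /negP]] //.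
  move: nNij; have := ijN y ys yA esy; have := ijN x xs xA esx.
  by case/orP=> /eqP xE; case/orP=> /eqP yE; subst x y; rewrite ?esx ?esy // eqxx in xy *.
have cA : (#|A :\ s| <= #|A|)%N by rewrite subset_leq_card // subsetDl.
wlog nsj : i j ij isn js s'i s'j fi fj nij nNij cij / ~~ e s j.
  move=> wl; have [esj|nsj] := boolP (e s j); last exact: (wl i j).
  apply: (wl j i) => //; first by rewrite eq_sym.
  - by rewrite eC.
  - by rewrite andbC.
  - by rewrite within_sym // setUCA.
  by move: nNij; rewrite esj andbT.
have es'j : e s' j by rewrite (negbTE nsj) orbF in fj.
have [es'i|nes'i] := boolP (e s' i).
  apply: leq_trans cA; apply: ltnW.
  by apply: (sep s' i j) => // c /nNA[].
rewrite (negbTE nes'i) /= in fi.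
(* The edge from [s'] to [i] is new, so the cycle goes through [s] instead: apex [s'], ends [s] and
   [j], with [i] among the connecting vertices. *)
suff : (q.+1 <= #|i |: (A :\ s)|)%N.
  by move=> h; rewrite -ltnS (leq_trans h) // (leq_trans (leq_card_setU1 _ _)).
apply: (sep s' s j) => //; first by rewrite eC.
- by rewrite eq_sym.
- move=> c; rewrite in_setU1 => /predU1P[->|/nNA[]//]; by rewrite eq_sym.
apply: (@connect_trans _ _ i); first by apply: connect1; rewrite /within /= fi !inE !eqxx ?orbT.
apply: connect_sub cij => x y /and3P[exy xA yA]; apply: connect1.
have sub z : z \in i |: (j |: (A :\ s)) -> z \in s |: (j |: (i |: (A :\ s))).
  by move=> zA; rewrite (setUCA [set j]) in_setU1 zA orbT.
by rewrite /within /= exy !sub.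
Qed.

(** * Vectors that are orthogonal at non-edges *)

Lemma gramE (R : pzSemiRingType) n k m (X : 'M[R]_(n, m)) (Y : 'M[R]_(k, m)) i j :
  (X *m Y^T) i j = (row i X *m (row j Y)^T) 0 0.
Proof. by rewrite !mxE; apply: eq_bigr => l _; rewrite !mxE. Qed.

Lemma gram_sym (R : comPzSemiRingType) n m (V : 'M[R]_(n, m)) i j :
  (V *m V^T) i j = (V *m V^T) j i.
Proof. by rewrite !mxE; apply: eq_bigr => l _; rewrite !mxE mulrC. Qed.

Definition restrict_rows (R : pzRingType) n m (T : {set 'I_n}) (V : 'M[R]_(n, m)) : 'M[R]_(n, m) :=
  \matrix_i (if i \in T then row i V else 0).

Lemma row_restrict (R : pzRingType) n m (T : {set 'I_n}) (V : 'M[R]_(n, m)) i :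
  row i (restrict_rows T V) = if i \in T then row i V else 0.
Proof. by rewrite rowK. Qed.

Lemma gram_restrict (R : pzRingType) k n m (T : {set 'I_n}) (X : 'M[R]_(k, m))
    (V : 'M[R]_(n, m)) i j :
  (X *m (restrict_rows T V)^T) i j = if j \in T then (X *m V^T) i j else 0.
Proof. by rewrite gramE row_restrict; case: ifP; rewrite -?gramE // trmx0 mulmx0 mxE. Qed.

Lemma restrict_sub (R : fieldType) n m (D T : {set 'I_n}) (V : 'M[R]_(n, m)) :
  D \subset T -> (restrict_rows D V <= restrict_rows T V)%MS.
Proof.
move=> DT; apply/row_subP => i; rewrite row_restrict; case: ifP => [iD|_]; last exact: sub0mx.
by have := row_sub i (restrict_rows T V); rewrite row_restrict (subsetP DT).
Qed.

Lemma row_gram_restrict0 (R : pzRingType) k n m (T : {set 'I_n}) (X : 'M[R]_(k, m))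
    (V : 'M[R]_(n, m)) i :
  (forall j, j \in T -> (X *m V^T) i j = 0) -> row i X *m (restrict_rows T V)^T = 0.
Proof.
move=> XV; apply/rowP => j; have XE := gram_restrict T X V i j.
rewrite -row_mul [RHS]mxE; transitivity ((X *m (restrict_rows T V)^T) i j).
  by rewrite /row mxE.
by rewrite XE; case: ifP => // /XV.
Qed.

Definition nonorthogonal (R : pzRingType) n m (V : 'M[R]_(n, m)) : rel 'I_n :=
  [rel i j | (i != j) && ((V *m V^T) i j != 0)].

(** Let [C] be the part of [T] reachable from [i], and [D] the rest. The spans of [C] and [D] are
    orthogonal and v_i is orthogonal to [D], so the projection of v_i lies in the span of [C].
    Without a connection, v_j is orthogonal to [C]. *)
Lemma connect_nonorthogonal (R : rcfType) n m (V : 'M[R]_(n, m)) (T : {set 'I_n}) (P : 'M_m) i j :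
  P^T = P -> restrict_rows T V *m P = restrict_rows T V -> (P <= restrict_rows T V)%MS ->
  i \notin T -> j \notin T -> (V *m P *m V^T) i j != 0 ->
  connect (within (nonorthogonal V) (i |: (j |: T))) i j.
Proof.
move=> PT WP PW iT jT; apply: contraNT => ncon.
pose C := [set x in T | connect (within (nonorthogonal V) (i |: T)) i x].
pose D := T :\: C.
pose WC := restrict_rows C V; pose WD := restrict_rows D V.
have WE : restrict_rows T V = WC + WD.
  apply/row_matrixP => x; rewrite linearD /= !row_restrict !inE.
  by case: (x \in T); case: (connect _ i x); rewrite /= ?addr0 ?add0r.
have DT : D \subset T by apply: subsetDl.
have oC x y : x \in i |: C -> y \in D -> (V *m V^T) x y = 0.
  rewrite !inE => xiC /andP[yC yT]; rewrite yT /= in yC.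
  apply/eqP; apply: contraNT yC => Gxy.
  have [xT ix] : x \in i |: T /\ connect (within (nonorthogonal V) (i |: T)) i x.
    by case/predU1P: xiC => [->|/andP[xT ix]]; rewrite !inE ?eqxx ?xT ?orbT.
  apply: connect_trans ix _; have [->//|xy] := eqVneq x y.
  by apply: connect1; apply/and3P; split=> //; [apply/andP | rewrite !inE yT orbT].
have oj x : x \in C -> (V *m V^T) j x = 0.
  rewrite inE => /andP[xT ix]; apply/eqP; apply: contraNT ncon => Gjx.
  apply: (@connect_trans _ _ x).
    apply: connect_sub ix => a b /and3P[ab aT bT]; apply: connect1.
    by apply/and3P; split=> //; rewrite setUCA in_setU1 ?aT ?bT orbT.
  apply: connect1; apply/and3P; rewrite !inE eqxx xT !orbT; split=> //; apply/andP.
  by split; [apply: contraNneq jT => <- | rewrite gram_sym].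
have CD : WC *m WD^T = 0.
  apply/matrixP => x y; rewrite gramE !row_restrict [RHS]mxE.
  case: ifP => [xC|_]; last by rewrite mul0mx mxE.
  case: ifP => [yD|_]; last by rewrite trmx0 mulmx0 mxE.
  by rewrite -gramE oC // inE xC orbT.
have iD : row i V *m WD^T = 0 by apply: row_gram_restrict0 => y yD; rewrite oC // setU11.
have jC : row j V *m WC^T = 0 by apply: row_gram_restrict0.
have /submxP[z zE] : (row i V *m P <= restrict_rows T V)%MS.
  exact: submx_trans (submxMl _ _) PW.
have PWD : P *m WD^T = WD^T.
  have /submxP[Q QE] := restrict_sub V DT.
  by rewrite -{1}PT -trmx_mul /WD QE -mulmxA WP.
(* The [D]-component of the projection of v_i is orthogonal to the [C]-component and to the
   projection itself, hence to itself. *)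
have d0 : z *m WD = 0.
  apply: mulmx_trmx_eq0; have : row i V *m P *m (z *m WD)^T = 0.
    by rewrite trmx_mul mulmxA -(mulmxA _ P) PWD iD mul0mx.
  by rewrite zE WE mulmxDr mulmxDl [(z *m WD)^T]trmx_mul !mulmxA -(mulmxA z WC) CD
    mulmx0 mul0mx add0r.
rewrite gramE row_mul zE WE mulmxDr d0 addr0 -mulmxA -[WC]trmxK -trmx_mul jC.
by rewrite trmx0 mulmx0 mxE.
Qed.

(* The inner vertices of a chordless path have a tridiagonal Gram matrix with
   nonzero off-diagonal entries, so its corank is at most one. *)
Lemma short_connection (R : rcfType) n m (V : 'M[R]_(n, m)) (T : {set 'I_n}) i j :
  i != j -> (V *m V^T) i j = 0 ->
  connect (within (nonorthogonal V) (i |: (j |: T))) i j ->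
  exists A : {set 'I_n}, [/\ A \subset T, (#|A| <= (\rank (restrict_rows T V)).+1)%N &
    connect (within (nonorthogonal V) (i |: (j |: A))) i j].
Proof.
move=> ij Gij cij; pose B := i |: (j |: T).
have [p [ep pj up chordless]] : exists p : seq 'I_n,
    [/\ path (within (nonorthogonal V) B) i p, last i p = j, uniq (i :: p) & forall a b,
      (a.+1 < b <= size p)%N ->
      ~~ within (nonorthogonal V) B (nth i (i :: p) a) (nth i (i :: p) b)].
  exact: shortest_path.
have [|{}ep subp] := path_within _ ep; first by rewrite !inE eqxx.
have inB k : (k < size p)%N -> nth i p k \in B.
  by move=> kp; apply: (subp _); rewrite inE mem_nth // orbT.
have {}chordless a b : (a.+1 < b < size p)%N -> (V *m V^T) (nth i p a) (nth i p b) = 0.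
  move=> abp; have := chordless a.+1 b.+1 abp; rewrite /within /= !inB ?andbT; try lia.
  rewrite negb_and !negbK => /orP[|/eqP//] /eqP abE.
  have /andP[_ up'] := up; have : (nth i p a == nth i p b) = (a == b).
    have [ap bp] : (a < size p)%N /\ (b < size p)%N by lia.
    exact: nth_uniq.
  by rewrite abE eqxx; lia.
have sp2 : (2 <= size p)%N.
  case: p ep pj {up chordless subp inB} => [|x [|y p]] //= => [_ ji|].
    by rewrite ji eqxx in ij.
  by rewrite andbT => /andP[_ +] xj; rewrite xj Gij eqxx.
have inT k : (k.+1 < size p)%N -> nth i p k \in T.
  move=> kp; have := inB k (ltnW kp); rewrite !in_setU1.
  have -> : (nth i p k == i) = false.
    by apply/negbTE; case/andP: up => + _; apply: contraNneq => <-; rewrite mem_nth // ltnW.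
  have -> // : (nth i p k == j) = false.
  have [ap bp] : (k < size p)%N /\ ((size p).-1 < size p)%N by lia.
  have /andP[_ up'] := up; rewrite -pj -(nth_last i); have -> := nth_uniq i ap bp up'.
  by lia.
have stake : size (take (size p).-1 p) = (size p).-1 by rewrite size_takel //; lia.
exists [set x in take (size p).-1 p]; split.
- apply/subsetP => x; rewrite inE => /(nthP i)[k + <-]; rewrite stake => kp.
  by rewrite nth_take // inT //; lia.
- rewrite cardsE; apply: leq_trans (card_size _) _; rewrite stake.
  (* Of the [(size p).-1] inner vertices, rows omit the last and columns the first. This puts the
     products of consecutive vectors on the diagonal. *)
  have := @rank_ge_triangular R ((size p).-2) n n (restrict_rows T V *m (restrict_rows T V)^T)
    (fun a => nth i p a) (fun a => nth i p a.+1).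
  rewrite mxrank_gram => h; suff : ((size p).-2 <= \rank (restrict_rows T V))%N by lia.
  apply: h => [a|a b ab].
    have ap := ltn_ord a; rewrite gram_restrict inT; last lia.
    rewrite gramE row_restrict inT; last lia.
    rewrite -gramE; have /= := pathP i ep a.+1; move/(_ _)/andP; case=> //; lia.
  have ap := ltn_ord b; rewrite gram_restrict inT; last lia.
  rewrite gramE row_restrict inT; last lia.
  by rewrite -gramE chordless //; lia.
apply/connectP; exists p => //; apply: within_path => // x.
rewrite inE !in_setU1 inE => /predU1P[->|/(nthP i)[k kp <-]]; first by rewrite eqxx.
have [->|kn] := eqVneq k (size p).-1; first by rewrite nth_last pj eqxx orbT.
have kp' : (k < (size p).-1)%N by have := kp : (k < size p)%N; lia.
by rewrite -(@nth_take (size p).-1) // mem_nth ?stake // !orbT.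
Qed.

(** * Vectors supported on a clique *)

Definition clique_supported (R : nmodType) n (e : rel 'I_n) (a : 'cV[R]_n) : Prop :=
  forall i j, i != j -> a i 0 != 0 -> a j 0 != 0 -> e i j.

Lemma row_mul0 (R : pzSemiRingType) n m k (A : 'M[R]_(n, m)) (B : 'M[R]_(m, k)) i :
  row i A = 0 -> row i (A *m B) = 0.
Proof. by move=> A0; rewrite row_mul A0 mul0mx. Qed.

Lemma row0_gram (R : comPzRingType) n m (V : 'M[R]_(n, m)) i j :
  row i V = 0 \/ row j V = 0 -> (V *m V^T) i j = 0.
Proof. by rewrite gramE => -[] ->; rewrite ?trmx0 ?mulmx0 ?mul0mx mxE. Qed.

Lemma row_apply0 (R : pzSemiRingType) n m (V : 'M[R]_(n, m)) (y : 'cV[R]_m) i :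
  row i V = 0 -> (V *m y) i 0 = 0.
Proof.
move=> /(row_mul0 y) /rowP/(_ 0); by rewrite [LHS]mxE [RHS]mxE.
Qed.

Lemma complement_projection (R : rcfType) n k m
    (V : 'M[R]_(n, m)) (W : 'M[R]_(k, m)) (P : 'M[R]_m) :
  P^T = P -> P *m P = P -> W *m P = W ->
  W *m (1%:M - P) = 0 /\
  V *m (1%:M - P) *m (V *m (1%:M - P))^T = V *m V^T - V *m P *m V^T.
Proof.
move=> PT PP WP; split; first by rewrite mulmxBr mulmx1 WP subrr.
rewrite trmx_mul mulmxA -(mulmxA V) linearB /= trmx1 PT mulmxBl mul1mx.
rewrite [P *m (1%:M - P)]mulmxBr mulmx1 PP subrr subr0.
by rewrite mulmxBr mulmx1 mulmxBl.
Qed.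

Lemma support_proper (R : nzRingType) n m (V : 'M[R]_(n, m)) (Q : 'M[R]_m) t :
  row t V != 0 -> row t (V *m Q) = 0 ->
  (#|[set i | row i (V *m Q) != 0%R]| < #|[set i | row i V != 0%R]|)%N.
Proof.
move=> Vt VQt; apply/proper_card/properP; split.
  apply/subsetP => i; rewrite !inE; apply: contraNN => /eqP Vi0.
  by apply/eqP; exact: row_mul0.
by exists t; rewrite !inE // VQt eqxx.
Qed.

Lemma clique_vector (R : rcfType) n m (e : rel 'I_n) (V : 'M[R]_(n, m)) :
  simple_graph e -> V != 0 ->
  (forall i j, i != j -> ~~ e i j -> (V *m V^T) i j = 0) ->
  apex_separated e (\rank V) ->
  exists y : 'cV[R]_m, V *m y != 0 /\ clique_supported e (V *m y).
Proof.
have [N] := ubnP #|[set i | row i V != 0]|; elim: N e V => // N IH e V leN sg V0 pat sep.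
have [eC eI] := sg.
have [[s t] /= /and4P[st nest Vs Vt]|nost] :=
  pickP (fun st : 'I_n * 'I_n => [&& st.1 != st.2, ~~ e st.1 st.2,
    row st.1 V != 0 & row st.2 V != 0]);
  last first.
  (* The nonzero vectors now sit on a clique, so any nonzero V y will do; y = v_s works because it
     is not orthogonal to itself. *)
  have [s Vs] : exists s, row s V != 0.
    have [s Vs|rowV0] := pickP (fun s => row s V != 0); first by exists s.
    case/eqP: V0; apply/row_matrixP => s; rewrite row0.
    exact: (eqP (negbFE (rowV0 s))).
  exists (row s V)^T; split.
    apply: contraNneq Vs => Vs0; apply/eqP/mulmx_trmx_eq0.
    by rewrite -row_mul Vs0 row0.
  move=> i j ij Vi Vj; apply: contraFT (nost (i, j)) => neij; rewrite /= ij neij /=.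
  apply/andP; split; first by apply: contraNneq Vi => /row_apply0->.
  by apply: contraNneq Vj => /row_apply0->.
have Gst : (V *m V^T) s t = 0 by exact: pat.
pose T := [set i | (i != s) && ~~ e s i].
have tT : t \in T by rewrite inE eq_sym st nest.
pose W := restrict_rows T V.
have VsW : row s V *m W^T = 0.
  by apply: row_gram_restrict0 => j; rewrite inE eq_sym => /andP[sj nesj]; exact: pat.
have WV : (W <= V)%MS.
  by apply/row_subP => i; rewrite row_restrict; case: ifP; rewrite ?sub0mx ?row_sub.
have [P [PT PP WP PW]] := orthogonal_projection W.
have [WQ gramQ] := complement_projection V PT PP WP.
have [/existsP[[i j] /= /and5P[ij neij VPV esi esj]]|good] :=
  boolP [exists ij : 'I_n * 'I_n, [&& ij.1 != ij.2, ~~ e ij.1 ij.2,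
    (V *m P *m V^T) ij.1 ij.2 != 0, e s ij.1 & e s ij.2]]; last first.
  (* Projecting orthogonally to [W] kills the vectors at [T], among them v_t, so the support
     shrinks; v_s is orthogonal to [W] and survives. *)
  have rowT i : i \in T -> row i (V *m (1%:M - P)) = 0.
    move=> iT; have := congr1 (row i) WQ.
    by rewrite !row_mul row0 row_restrict iT.
  have [|||i j ij neij||y [y0 ycl]] := IH e (V *m (1%:M - P)); rewrite ?mulmxA.
  - by rewrite -ltnS (leq_trans _ leN) // ltnS (@support_proper _ _ _ _ _ t) // rowT.
  - by [].
  - apply: contraNneq Vs => /(congr1 (row s)); rewrite row_mul row0 mulmxBr mulmx1.
    by rewrite (projection_ortho0 PT PW VsW) subr0 => ->.
  - have [iT|iT] := boolP (i \in T); first by rewrite row0_gram //; left; exact: rowT.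
    have [jT|jT] := boolP (j \in T); first by rewrite row0_gram //; right; exact: rowT.
    move: iT jT; rewrite !inE !negb_and !negbK.
    have [is_|is_ /= esi] := eqVneq i s; first by rewrite -is_ eq_sym (negbTE ij) (negbTE neij).
    have [js|js /= esj] := eqVneq j s; first by rewrite -js eC (negbTE neij) in esi.
    rewrite gramQ mxE pat // mxE add0r; apply/eqP; rewrite oppr_eq0.
    apply: contraNT good => VPV; apply/existsP; exists (i, j) => /=.
    by rewrite ij neij VPV esi.
  - by apply: apex_separatedW sep; exact: mxrankM_maxl.
  by exists ((1%:M - P) *m y); rewrite mulmxA.
have iT : i \notin T by rewrite inE esi andbF.
have jT : j \notin T by rewrite inE esj andbF.
have [A [AT cA conA]] := short_connection ij (pat _ _ ij neij)
  (connect_nonorthogonal PT WP PW iT jT VPV).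
(* Separation bounds [A] from below by [\rank V], the tridiagonal estimate bounds it from above by
   [(\rank W).+1]. *)
have rkW : (\rank V <= (\rank W).+1)%N.
  apply: leq_trans cA; apply: (sep s i j) => // [c /(subsetP AT)|]; first by rewrite inE => /andP[].
  apply: connect_sub conA => x y /and3P[/andP[xy Gxy] xA yA]; apply: connect1.
  by apply/and3P; split=> //; apply: contraNT Gxy => /(pat _ _ xy)->.
have span : (V <= W + row s V)%MS.
  have sub : (W + row s V <= V)%MS by rewrite addsmx_sub WV row_sub.
  rewrite -(mxrank_leqif_sup sub) eqn_leq mxrankS //= (leq_trans rkW) //.
  apply: rank_ltmx; rewrite ltmxE addsmxSl addsmx_sub submx_refl /=.
  apply: contra Vs => /submxP[z zE]; apply/eqP/mulmx_trmx_eq0.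
  by rewrite {2}zE trmx_mul mulmxA VsW mul0mx.
have [S [ST SS VS SV]] := orthogonal_projection (row s V).
have [VsQ gramS] := complement_projection V ST SS VS.
set Q := 1%:M - S in VsQ gramS.
have rows : row s (V *m Q) = 0 by rewrite row_mul.
have ort0 x : (V *m V^T) x s = 0 -> row x V *m S = 0.
  move=> Gxs; apply: (projection_ortho0 ST SV); apply/matrixP => a b.
  by rewrite !ord1 -gramE Gxs mxE.
have VQ0 : V *m Q != 0.
  apply: contraNneq Vt => /(congr1 (row t)); rewrite row_mul row0 mulmxBr mulmx1.
  by rewrite ort0 ?subr0 1?gram_sym // => ->.
(* This drop in rank pays for the unit that separation loses in the filled graph. *)
have rkQ : (\rank (V *m Q) < \rank V)%N.
  have QQ : Q *m Q = Q by rewrite /Q mulmxBr mulmx1 mulmxBl mul1mx SS subrr subr0.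
  apply: rank_ltmx; rewrite ltmxE.
  have -> /= : (V *m Q <= V)%MS.
    rewrite mulmxBr mulmx1 addmx_sub // eqmx_opp.
    by have /submxP[D ->] := SV; rewrite mulmxA (submx_trans (submxMl _ _)) // row_sub.
  apply: contra Vs => /(submx_trans (row_sub s V))/submxP[z zE].
  by apply/eqP; have := VsQ; rewrite zE -!mulmxA QQ.
have [|||||y [y0 ycl]] := IH (fill s e) (V *m Q).
- by rewrite -ltnS (leq_trans _ leN) // ltnS (@support_proper _ _ _ _ _ s).
- exact: fill_simple.
- exact: VQ0.
- move=> x z xz; rewrite /fill /= xz.
  have [->|xs] := eqVneq x s; first by move=> _; apply: row0_gram; left.
  have [->|zs] := eqVneq z s; first by move=> _; apply: row0_gram; right.
  rewrite /= negb_or negb_and => /andP[nexz nN].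
  rewrite gramS mxE pat // mxE add0r; apply/eqP; rewrite oppr_eq0; apply/eqP.
  have [nx|nz] := orP nN.
    by rewrite gramE row_mul (ort0 x) ?mul0mx; [rewrite mxE | rewrite pat // eC].
  rewrite -ST -mulmxA -trmx_mul gramE row_mul (ort0 z).
    by rewrite trmx0 mulmx0 mxE.
  by rewrite pat // eC.
- apply: apex_separated_fill => //; exact: apex_separatedW sep.
rewrite -mulmxA in y0 ycl; set a := V *m (Q *m y) in y0 ycl.
exists (Q *m y); split=> // i0 j0 ij0 ai aj; apply/negPn/negP => neij0; case/negP: y0.
have a_s : a s 0 = 0 by rewrite /a mulmxA; exact: row_apply0.
have /and4P[i0s j0s _ ] := ycl _ _ ij0 ai aj; rewrite (negbTE neij0) /= => /andP[esi0 esj0].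
(* A support vertex [c] outside N(s) is joined to [i0] and [j0] by edges of [e], so the singleton of
   [c] connects them. Separation then gives [\rank V <= 1], while [V *m Q] is nonzero of smaller
   rank. *)
have suppN c : a c 0 != 0 -> e s c.
  move=> ac; apply/negPn/negP => nesc.
  have cs : c != s by apply: contraNneq ac => ->; rewrite a_s.
  have [ci cj] : c != i0 /\ c != j0 by split; apply: contraNneq nesc => ->.
  have /and4P[_ _ _] := ycl _ _ ci ac ai; rewrite (negbTE nesc) orbF => eci.
  have /and4P[_ _ _] := ycl _ _ cj ac aj; rewrite (negbTE nesc) orbF => ecj.
  have := sep s i0 j0 [set c] esi0 esj0 ij0 neij0; rewrite cards1 => h.
  have : (\rank V <= 1)%N.
    apply: h => [d|]; first by rewrite inE => /eqP->.
    by apply: (@connect_trans _ _ c); apply: connect1;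
      rewrite /within /= ?(eC i0) ?eci ?ecj !inE !eqxx ?orbT.
  have : (0 < \rank (V *m Q))%N by rewrite lt0n mxrank_eq0.
  by move=> r0 r1; have := leq_trans rkQ r1; rewrite ltnNge r0.
have /sub_addsmxP[[u v] /= VE] := span.
rewrite /a VE mulmxDl -!mulmxA.
have -> : W *m (Q *m y) = 0.
  apply/row_matrixP => x; rewrite row_mul row_restrict row0.
  case: ifP => [|_]; last by rewrite mul0mx.
  rewrite inE => /andP[xs nesx]; apply/rowP => k; rewrite ord1 -row_mul [LHS]mxE [RHS]mxE -/a.
  by apply/eqP; apply: contraNT nesx; exact: suppN.
have -> : row s V *m (Q *m y) = 0 by rewrite mulmxA VsQ mul0mx.
by rewrite !mulmx0 addr0.
Qed.

(** * Extreme rays *)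

Lemma in_sigma_dualP (R : rcfType) n (e : rel 'I_n) (L : 'M[R]_n) :
  in_sigma_dual e L <-> psd L /\ (forall i j, i != j -> ~~ e i j -> L i j = 0).
Proof.
split=> [[LT pat L0]|[[LT L0] pat]].
  by split=> //; split=> // x; have := L0 1%N (fun=> x); rewrite big_ord1.
by split=> // m fs; apply: sumr_ge0 => k _; exact: L0.
Qed.

Lemma psd_congr (R : rcfType) n k (A : 'M[R]_k) (X : 'M[R]_(n, k)) :
  psd A -> psd (X *m A *m X^T).
Proof.
move=> [AT A0]; split=> [|x]; first by rewrite !trmx_mul trmxK AT mulmxA.
by have := A0 (X^T *m x); rewrite trmx_mul trmxK !mulmxA.
Qed.

Lemma induced_cycle_of_extreme_ray (R : rcfType) n (e : rel 'I_n) (L : 'M[R]_n) :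
  simple_graph e -> extreme_ray e L -> (2 <= \rank L)%N ->
  (forall k, (4 <= k <= \rank L + 2)%N -> ~ has_induced_cycle e k) -> False.
Proof.
move=> sg [/in_sigma_dualP[pL pat] L0 ext] rL ncyc.
have [m [V LV]] := psd_factor pL.
have [|i j ij neij||y [y0 ycl]] := @clique_vector R n m e V sg.
- by apply: contraNneq L0 => V0; rewrite LV V0 mul0mx.
- by rewrite -LV pat.
- by rewrite -mxrank_gram -LV; exact: no_short_cycle_separated.
move aV: (V *m y) y0 ycl => a y0 ycl.
set N := (y^T *m y) 0 0.
have N0 : 0 < N.
  have NN : 0 <= N by have := mulmx_trmx_ge0 y^T; rewrite trmxK.
  rewrite lt_def NN andbT; apply: contraNneq y0 => N0.
  have : y^T = 0 by apply: mulmx_trmx_eq0; rewrite trmxK [LHS]mx11_scalar -/N N0 raddf0.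
  by rewrite -aV => /(congr1 trmx); rewrite trmxK trmx0 => ->; rewrite mulmx0.
set A := N^-1 *: (a *m a^T).
have aE (x : 'cV[R]_n) : (x^T *m A *m x) 0 0 = N^-1 * (x^T *m a) 0 0 ^+ 2.
  rewrite -scalemxAr -scalemxAl mxE !mulmxA -[_ *m a^T *m x]mulmxA mulmx11 expr2.
  by rewrite -[(a^T *m x) 0 0]trace_mx11 -mxtrace_tr trmx_mul trmxK trace_mx11.
have aT : A^T = A by rewrite linearZ /= trmx_mul trmxK.
have apat i j : i != j -> ~~ e i j -> A i j = 0.
  move=> ij neij; rewrite mxE mxE big_ord1 [a^T _ _]mxE.
  have [->|ai] := eqVneq (a i 0) 0; first by rewrite mul0r mulr0.
  have [->|aj] := eqVneq (a j 0) 0; first by rewrite !mulr0.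
  by rewrite ycl in neij.
have rA : (\rank A <= 1)%N.
  by rewrite (leq_trans (mxrank_scale _ _)) // (leq_trans (mxrankM_maxl _ _)) ?rank_leq_col.
have A0 : A != 0.
  rewrite scaler_eq0 invr_eq0 (gt_eqF N0) /=; apply: contraNneq y0 => aa0.
  apply/eqP/colP => i; have /matrixP/(_ i i) := aa0.
  by rewrite mxE big_ord1 !mxE => /eqP; rewrite mulf_eq0 orbb => /eqP.
(* Cauchy-Schwarz for V^T x and [y] in the standard inner product, written with the identity as its
   own Gram matrix; this is why [A] is divided by [N]. *)
have AL (x : 'cV[R]_n) : (x^T *m A *m x) 0 0 <= (x^T *m L *m x) 0 0.
  rewrite aE mulrC ler_pdivrMr //.
  have := psd_CauchySchwarz (V^T *m x) y (psd_gram 1%:M).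
  by rewrite trmx1 !mulmx1 trmx_mul trmxK -/N LV -aV !mulmxA.
clearbody A.
have dA : in_sigma_dual e A.
  apply/in_sigma_dualP; split=> //; split=> // x.
  by rewrite aE mulr_ge0 ?sqr_ge0 // invr_ge0 ltW.
have dB : in_sigma_dual e (L - A).
  apply/in_sigma_dualP; split=> [|i j ij neij]; last first.
    by rewrite mxE [X in _ + X]mxE pat // apat // subr0.
  split=> [|x]; first by rewrite linearB /= aT pL.1.
  by rewrite mulmxBr mulmxBl mxE [X in _ + X]mxE subr_ge0 AL.
have [|c c0 cE] := ext _ _ dA dB; first by rewrite addrC subrK.
have cn0 : c != 0 by apply: contraNneq A0 => c0'; rewrite cE c0' scale0r.
by move: rA; rewrite cE mxrank_scale_nz // leqNgt rL.
Qed.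

Definition embed_mx (R : pzRingType) k n (w : 'I_k -> 'I_n) : 'M[R]_(n, k) :=
  \matrix_(x, i) (x == w i)%:R.

Lemma embed_mxK (R : pzRingType) k n (w : 'I_k -> 'I_n) : injective w ->
  (embed_mx R w)^T *m embed_mx R w = 1%:M.
Proof.
move=> winj; apply/matrixP => i j; rewrite !mxE (bigD1 (w i)) //= big1 ?addr0 => [|x xi].
  by rewrite !mxE eqxx mul1r (inj_eq winj).
by rewrite !mxE (negbTE xi) mul0r.
Qed.

Lemma embed_mx_congr (R : pzRingType) k n (w : 'I_k -> 'I_n) (A : 'M[R]_n) i j :
  ((embed_mx R w)^T *m A *m embed_mx R w) i j = A (w i) (w j).
Proof.
rewrite mxE (bigD1 (w j)) //= big1 ?addr0 => [|x xj]; last first.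
  by rewrite [X in _ * X]mxE (negbTE xj) mulr0.
rewrite [X in _ * X]mxE eqxx mulr1 mxE (bigD1 (w i)) //= big1 ?addr0 => [|x xi].
  by rewrite !mxE eqxx mul1r.
by rewrite !mxE (negbTE xi) mul0r.
Qed.

Lemma row_embed0 (R : pzRingType) k n (w : 'I_k -> 'I_n) x :
  (forall i, x != w i) -> row x (embed_mx R w) = 0.
Proof. by move=> xw; apply/rowP => i; rewrite !mxE (negbTE (xw i)). Qed.

Lemma extreme_ray_embed (R : rcfType) k n (w : 'I_k -> 'I_n) (e : rel 'I_n) (L : 'M[R]_k) :
  injective w -> extreme_ray (fun i j => e (w i) (w j)) L ->
  extreme_ray e (embed_mx R w *m L *m (embed_mx R w)^T) /\
  \rank (embed_mx R w *m L *m (embed_mx R w)^T) = \rank L.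
Proof.
move=> winj [/in_sigma_dualP[pL pat] L0 ext]; set E := embed_mx R w.
have EE : E^T *m E = 1%:M by exact: embed_mxK.
have LE : E^T *m (E *m L *m E^T) *m E = L by rewrite !mulmxA EE mul1mx -mulmxA EE mulmx1.
split; last first.
  apply/eqP; rewrite eqn_leq (leq_trans (mxrankM_maxl _ _) (mxrankM_maxr _ _)) /=.
  by rewrite -{1}LE (leq_trans (mxrankM_maxl _ _) (mxrankM_maxr _ _)).
split.
- apply/in_sigma_dualP; split=> [|x y xy nexy]; first exact: psd_congr.
  have [i /eqP xi|xw] := pickP (fun i => x == w i); last first.
    by rewrite gramE row_mul row_embed0 ?mul0mx ?mxE // => i; rewrite xw.
  have [j /eqP yj|yw] := pickP (fun j => y == w j); last first.
    by rewrite gramE [row y _]row_embed0 ?trmx0 ?mulmx0 ?mxE // => j; rewrite yw.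
  rewrite xi yj -embed_mx_congr -/E LE pat // -?xi -?yj //.
  by apply: contraNneq xy => ij; rewrite xi yj ij.
- by apply: contraNneq L0 => E0; rewrite -LE E0 mulmx0 mul0mx.
move=> A B dA dB LAB.
have sub M : in_sigma_dual e M -> in_sigma_dual (fun i j => e (w i) (w j)) (E^T *m M *m E).
  move=> /in_sigma_dualP[pM patM]; apply/in_sigma_dualP; split=> [|i j ij neij].
    by have := psd_congr E^T pM; rewrite trmxK.
  by rewrite embed_mx_congr patM // (inj_eq winj).
have [|c c0 Ac] := ext _ _ (sub _ dA) (sub _ dB).
  by rewrite -LE LAB mulmxDr mulmxDl.
exists c => //.
have /in_sigma_dualP[pA _] := dA; have /in_sigma_dualP[pB _] := dB.
(* [A] inherits the kernel of the embedded ray, which contains the unit vectors outside the image of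
   [w]; hence its restriction to that image determines it. *)
have AE : A = A *m (E *m E^T).
  apply/esym/eqP; rewrite -subr_eq0 -{2}[A]mulmx1 -mulmxBr.
  apply/eqP; apply: (psd_le_ker (L := E *m L *m E^T)) => //.
    by rewrite LAB addrC addKr.
  by rewrite mulmxBr mulmx1 -!mulmxA (mulmxA E^T) EE mul1mx subrr.
have EA : A = E *m E^T *m A by rewrite -{1}pA.1 {1}AE !trmx_mul trmxK pA.1.
by rewrite {1}EA {1}AE scalemxAl scalemxAr -Ac !mulmxA.
Qed.

(** * The cycle *)

Definition cycle_rel k : rel 'I_k :=
  fun i j => (val j == i.+1 %% k)%N || (val i == j.+1 %% k)%N.

(* The first p + 1 rows telescope, so an affine function of the row index is a
   linear relation once the last row gets its slope as coefficient. *)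
Definition cycle_vectors (R : pzRingType) p : 'M[R]_(p.+2, p) :=
  \matrix_(i, a) if (i : nat) == p.+1 then 1 else (i == a :> nat)%:R - (i == a.+1 :> nat)%:R.

Definition cycle_kernel (R : pzRingType) p (al be : R) : 'cV[R]_p.+2 :=
  \col_i if (i : nat) == p.+1 then be else al + be * i%:R.

Lemma sum_delta (R : pzRingType) k m (f : nat -> R) : (m < k)%N ->
  \sum_(i < k) (i == m :> nat)%:R * f i = f m.
Proof.
move=> mk; rewrite (bigD1 (Ordinal mk)) //= eqxx mul1r big1 ?addr0 // => i im.
by rewrite -val_eqE /= in im; rewrite (negbTE im) mul0r.
Qed.

Lemma cycle_vectors_kernel (R : comPzRingType) p (al be : R) :
  (cycle_vectors R p)^T *m cycle_kernel p al be = 0.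
Proof.
apply/colP => a; rewrite mxE big_ord_recr /= !mxE /= eqxx mul1r.
rewrite (eq_bigr (fun i : 'I_p.+1 => (i == a :> nat)%:R * (al + be * i%:R)
    - (i == a.+1 :> nat)%:R * (al + be * i%:R))) => [|i _].
  have ap := ltn_ord a.
  rewrite sumrB !(@sum_delta _ _ _ (fun i => al + be * i%:R)) ?ltnS //; last exact: ltnW.
  by rewrite -natr1; ring.
by rewrite !mxE /= ltn_eqF // mulrBl.
Qed.

Definition cycle_matrix (R : pzRingType) p : 'M[R]_p.+2 :=
  cycle_vectors R p *m (cycle_vectors R p)^T.

Lemma rank_cycle_matrix (R : rcfType) p : \rank (cycle_matrix R p) = p.
Proof.
rewrite mxrank_gram; apply/eqP; rewrite eqn_leq rank_leq_col /=.
have wp (a : 'I_p) : (a < p.+2)%N by rewrite ltnW // ltnW // !ltnS.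
apply: (@rank_ge_triangular _ p _ _ _ (fun a => Ordinal (wp a)) id) => [a|a b ab].
  by rewrite mxE /= (ltn_eqF (leqW (ltn_ord a))) eqxx (ltn_eqF (ltnSn a)) subr0 oner_eq0.
by rewrite mxE /= (ltn_eqF (leqW (ltn_ord a))) (ltn_eqF ab) (ltn_eqF (leqW ab)) subr0.
Qed.

Lemma cycle_matrix_pattern (R : comPzRingType) p (i j : 'I_p.+2) : (2 <= p)%N ->
  i != j -> ~~ cycle_rel i j -> cycle_matrix R p i j = 0.
Proof.
move=> p2; wlog ij : i j / (i <= j)%N => [wl|].
  case: (leqP i j) => [|/ltnW] ij; first exact: wl.
  by rewrite eq_sym /cycle_rel orbC /cycle_matrix gram_sym; exact: wl.
have ijp : (i <= j < p.+2)%N by rewrite ij ltn_ord.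
have p3 : (3 <= p.+2)%N by rewrite !ltnS ltnW.
rewrite -val_eqE /= => nij; rewrite /cycle_rel /= cyclic_succ //.
rewrite negb_or => /andP[ji1]; rewrite eqSS => i0jp.
have ip : (i < p.+1)%N by have := ltn_ord j; lia.
rewrite mxE; under eq_bigr => a _ do rewrite !mxE (ltn_eqF ip).
have [jp|jp] := eqVneq (j : nat) p.+1; last first.
  rewrite big1 // => a _.
  by do 4 case: eqP; rewrite ?subr0 ?subrr ?mulr0 ?mul0r //; lia.
rewrite jp eqxx andbT in i0jp.
under eq_bigr => a _ do rewrite mulr1.
(* Vertex 0 is adjacent to the last one, so [i] is positive. The last vector is all ones, and the
   coordinates of vector [i] sum to 1 - 1. *)
have [m im] : exists m, i = m.+1 :> nat by exists (i : nat).-1; lia.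
rewrite sumrB.
rewrite (eq_bigr (fun a : 'I_p => (a == i :> nat)%:R * 1)) => [|a _]; last by rewrite eq_sym mulr1.
rewrite [X in _ - X](eq_bigr (fun a : 'I_p => (a == m :> nat)%:R * 1)) => [|a _]; last first.
  by rewrite im eqSS eq_sym mulr1.
by rewrite !(@sum_delta _ _ _ (fun=> 1)) ?subrr //; lia.
Qed.

(** Rows vanish in increasing order. By symmetry earlier rows clear everything to the left, so
    besides the diagonal at most one entry is left: the next one, or in row 0 the last one, since
    [D 0 1 = 0]. *)
Lemma cycle_rigid (R : rcfType) p (D : 'M[R]_p.+2) : (2 <= p)%N -> D^T = D ->
  (forall i j, i != j -> ~~ cycle_rel i j -> D i j = 0) ->
  D 0 1 = 0 -> (forall al be, D *m cycle_kernel p al be = 0) -> D = 0.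
Proof.
move=> p2 DT pat D01 ker.
have p3 : (3 <= p.+2)%N by rewrite !ltnS ltnW.
have Dsym i j : D i j = D j i by rewrite -{1}DT mxE.
have single (x a : 'I_p.+2) (al be : R) :
    (forall i, i != a -> D x i = 0 \/ cycle_kernel p al be i 0 = 0) ->
    cycle_kernel p al be a 0 != 0 -> D x a = 0.
  move=> zero ua; have /matrixP/(_ x 0) := ker al be; rewrite mxE (bigD1 a) //= big1 => [|i ia].
    by rewrite addr0 [RHS]mxE => /eqP; rewrite mulf_eq0 (negbTE ua) orbF => /eqP.
  by case: (zero i ia) => ->; rewrite ?mul0r ?mulr0.
have ker10 (i : 'I_p.+2) : cycle_kernel p 1 (0 : R) i 0 = (i != p.+1 :> nat)%:R.
  by rewrite mxE; case: eqP => //= _; rewrite mul0r addr0.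
have ker01 (i : 'I_p.+2) : (0 < i)%N -> cycle_kernel p 0 (1 : R) i 0 != 0.
  by move=> i0; rewrite mxE; case: ifP => _; rewrite /= ?oner_eq0 // add0r mul1r pnatr_eq0 -lt0n.
(* In a row supported on [x] and [y], a kernel vector vanishing only at [y] among the two kills the
   entry at [x]; the one with [al = 0], [be = 1], nonzero off index 0, then kills the entry at
   [y]. *)
have pair (x y : 'I_p.+2) (al be : R) : (forall i, i != x -> i != y -> D x i = 0) -> (0 < y)%N ->
    cycle_kernel p al be y 0 = 0 -> cycle_kernel p al be x 0 != 0 -> forall i, D x i = 0.
  move=> zero y0 uy ux.
  have Dxx : D x x = 0.
    apply: (single _ _ al be) ux => i ix; have [->|iy] := eqVneq i y; first by right.
    by left; exact: zero.
  have Dxy : D x y = 0.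
    apply: (single _ _ 0 1) (ker01 _ y0) => i iy; left.
    by have [->|ix] := eqVneq i x; [|exact: zero].
  by move=> i; have [->//|ix] := eqVneq i x; have [->//|iy] := eqVneq i y; exact: zero.
suff rows k (x : 'I_p.+2) : x = k :> nat -> forall i, D x i = 0.
  by apply/matrixP => x i; rewrite [RHS]mxE; exact: (rows x).
elim/ltn_ind: k x => k IH x xk.
have far (i : 'I_p.+2) : (0 < x)%N -> i != x -> (i != x.+1 :> nat) -> D x i = 0.
  move=> x0 ix ix1; case: (ltnP i x) => xi; first by rewrite Dsym (IH i) // -xk.
  apply: pat; rewrite 1?eq_sym // /cycle_rel /= cyclic_succ ?xi ?ltn_ord //.
  by rewrite (negbTE ix1) (gtn_eqF x0).
have xp := ltn_ord x.
have [x0|x0] := eqVneq (x : nat) 0%N.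
  apply: (pair x ord_max 1 0) => // [i ix im||]; rewrite ?ker10 /= ?eqxx ?x0 ?oner_eq0 //.
  have xE : x = 0 by apply: val_inj.
  have [i1|i1] := eqVneq (i : nat) 1%N.
    by have -> : i = 1; [apply: val_inj; rewrite /= i1 | rewrite xE].
  apply: pat; rewrite 1?eq_sym // /cycle_rel /= cyclic_succ ?ltn_ord ?x0 //.
  by rewrite (negbTE i1) /= eqSS; move: im; rewrite -val_eqE.
rewrite -lt0n in x0.
have [xm|xm] := eqVneq (x : nat) p.+1.
  move=> i; have [->|ix] := eqVneq i x.
    apply: (single x x 0 1) (ker01 x x0) => j jx; left.
    by apply: far => //; have := ltn_ord j; rewrite xm; lia.
  by apply: far => //; have := ltn_ord i; rewrite xm; lia.
have yp : (x.+1 < p.+2)%N by lia.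
have [xp'|xp'] := eqVneq (x : nat) p.
  apply: (pair x (Ordinal yp) 1 0) => // [i ix iy||]; rewrite ?ker10 /= ?xp' ?eqxx //.
    by apply: far.
  by rewrite (ltn_eqF (ltnSn p)) oner_eq0.
(* This affine function has its zero at index x + 1 and takes the value -1 at [x]. *)
apply: (pair x (Ordinal yp) (- x.+1%:R) 1) => // [i ix iy||].
- by apply: far.
- by rewrite mxE /= eqSS (negbTE xp') mul1r addNr.
by rewrite mxE (negbTE xm) mul1r -natr1 opprD addrAC addNr add0r oppr_eq0 oner_eq0.
Qed.

Lemma subZmxE (R : pzRingType) m n (A L : 'M[R]_(m, n)) c i j :
  (A - c *: L) i j = A i j - c * L i j.
Proof. by rewrite !mxE. Qed.

Lemma cycle_extreme (R : rcfType) p :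
  (2 <= p)%N -> extreme_ray (@cycle_rel p.+2) (cycle_matrix R p).
Proof.
move=> p2; have p0 : (0 < p)%N by exact: ltnW.
have Lker al be : cycle_matrix R p *m cycle_kernel p al be = 0.
  by rewrite -mulmxA cycle_vectors_kernel mulmx0.
have Lpat := @cycle_matrix_pattern R p.
have pL : psd (cycle_matrix R p) by exact: psd_gram.
have V0 (a : 'I_p) : cycle_vectors R p 0 a = (a == 0%N :> nat)%:R * 1.
  by rewrite mxE /= subr0 mulr1 eq_sym.
have LE j : cycle_matrix R p 0 j = cycle_vectors R p j (Ordinal p0).
  rewrite mxE (bigD1 (Ordinal p0)) //= big1 ?addr0 => [|a a0].
    by rewrite V0 !mul1r mxE.
  by rewrite V0 -val_eqE in a0 *; rewrite (negbTE a0) !mul0r.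
have L00 : cycle_matrix R p 0 0 = 1 by rewrite LE V0 mulr1.
have L01 : cycle_matrix R p 0 1 = - 1.
  by rewrite LE mxE /= eqSS (ltn_eqF p0) /= sub0r.
split.
- by apply/in_sigma_dualP; split=> // i j; exact: Lpat.
- by apply: contra_eq_neq L00 => ->; rewrite mxE eq_sym oner_eq0.
move=> A B /in_sigma_dualP[pA patA] /in_sigma_dualP[pB _] LAB.
(* As [L01] is -1, this multiple cancels the entry at (0, 1), and the difference still has the
   two-dimensional kernel. *)
have AE : A - (- A 0 1) *: cycle_matrix R p = 0.
  apply: cycle_rigid => //.
  - by rewrite linearB linearZ /= pA.1 pL.1.
  - by move=> i j ij nij; rewrite subZmxE (patA i j) // (Lpat i j) // mulr0 subr0.
  - by rewrite subZmxE L01 mulrN1 opprK subrr.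
  move=> al be; rewrite mulmxBl -scalemxAl Lker scaler0 subr0.
  by apply: psd_le_ker (Lker al be) => //; rewrite LAB addrC addKr.
have {}AE : A = (- A 0 1) *: cycle_matrix R p by apply/eqP; rewrite -subr_eq0 AE.
exists (- A 0 1) => //.
(* By [L00] the coefficient equals [A 0 0], a value of a semidefinite form. *)
have := pA.2 (delta_mx 0 0); rewrite form_delta {1}AE [X in _ <= X]mxE L00 mulr1 //.
Qed.

Lemma has_extreme_ray_of_cycle (R : rcfType) n (e : rel 'I_n) p : (2 <= p)%N ->
  has_induced_cycle e (p + 2) -> has_extreme_ray_of_rank R e p.
Proof.
move=> p2; rewrite addn2 => -[_ [w [winj ew]]].
have [] := @extreme_ray_embed R _ _ w e (cycle_matrix R p) winj.
  have [/in_sigma_dualP[pL pat] L0 ext] := @cycle_extreme R p p2.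
  have sub M : in_sigma_dual (fun i j => e (w i) (w j)) M -> in_sigma_dual (@cycle_rel p.+2) M.
    case/in_sigma_dualP=> pM patM; apply/in_sigma_dualP; split=> // i j ij nij.
    by apply: patM; rewrite ?ew.
  split=> //; last by move=> A B /sub dA /sub dB; exact: ext.
  by apply/in_sigma_dualP; split=> // i j ij; rewrite ew; exact: pat.
rewrite rank_cycle_matrix => ext rk.
by exists (embed_mx R w *m cycle_matrix R p *m (embed_mx R w)^T).
Qed.

(** * Comparison of the two indices *)

Lemma has_induced_cycle_dec n (e : rel 'I_n) k :
  has_induced_cycle e k \/ ~ has_induced_cycle e k.
Proof.
have [k3|k3] := boolP (3 <= k)%N; last by right=> -[]; rewrite (negbTE k3).
have [/existsP[v /andP[/injectiveP vinj /forallP ev]]|nv] := boolP [exists v : {ffun 'I_k -> 'I_n},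
    injectiveb v && [forall i, forall j, e (v i) (v j) == cycle_rel i j]].
  by left; split=> //; exists v; split=> // i j; apply/eqP/(forallP (ev i)).
right=> -[_ [v [vinj ev]]]; case/existsP: nv; exists [ffun i => v i].
apply/andP; split; first by apply/injectiveP => i j; rewrite !ffunE => /vinj.
by apply/'forall_forallP => i j; rewrite !ffunE ev.
Qed.

Theorem theorem6p5 (R : rcfType) (n : nat) (e : rel 'I_n) :
  simple_graph e ->
  forall eta : option nat, hankel_index_is R e eta <-> cycle_index_is e eta.
Proof.
move=> sg [p|] /=; last first.
  split=> [rk1 k k4 cyc|ncyc L extL].
    have [||L [/rk1 ->]] := @has_extreme_ray_of_cycle R n e (k - 2); [lia| |lia].
    by rewrite subnK //; exact: ltnW (ltnW k4).
  have [rL|rL] := ltnP 1 (\rank L).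
    by case: (induced_cycle_of_extreme_ray sg extL rL) => k /andP[k4 _]; exact: ncyc.
  have [_ L0 _] := extL; rewrite -mxrank_eq0 -lt0n in L0.
  by apply/eqP; rewrite eqn_leq rL.
split=> -[p2 hp minp]; split=> //.
(* Deciding existence by finite search allows arguing by contradiction: a shorter cycle would give a
   ray of smaller rank, so no induced cycle of length 4 to [p + 2] would be left, and a ray of rank
   [p] could not be extreme. *)
- have [//|ncyc] := has_induced_cycle_dec e (p + 2).
  have [L [extL rL]] := hp; exfalso.
  apply: (induced_cycle_of_extreme_ray sg extL); rewrite rL // => k /andP[k4 kp] cyc.
  have [kE|kp'] := eqVneq k (p + 2)%N; first by rewrite kE in cyc.
  apply: (minp (k - 2)%N); [lia|lia|apply: has_extreme_ray_of_cycle; first lia].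
  by rewrite subnK //; exact: ltnW (ltnW k4).
- by move=> q q2 qp /(has_extreme_ray_of_cycle R q2); exact: minp.
- exact: has_extreme_ray_of_cycle.
move=> q q2 qp [L [extL rL]]; apply: (induced_cycle_of_extreme_ray sg extL);
  rewrite rL // => k /andP[k4 kq] cyc.
by apply: (minp (k - 2)%N); [lia|lia|rewrite subnK //; exact: ltnW (ltnW k4)].
Qed.
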